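(* Let $q\in\mathbb{N}$ and let $W_1,\ldots,W_q$, $C$ be as defined in the context. Let $\{\sigma_k\}_{k\ge0}$ be an i.i.d. sequence in $\{1,\ldots,q\}$ with $\mathbf{Pr}(\sigma_k=r)=\pi_r$, and let $Y^{k+1}=W_{\sigma_k}Y^k+C$ with deterministic initial vector $Y^0$ (stochastic asynchronous algorithm). Assume $\rho\left(\sum_{r=1}^q\pi_r(W_r\otimes W_r)\right)<1$ and let $Y^\star$ be the fixed point, satisfying $Y^\star=W_rY^\star+C$ for all $r$. Put $\Lambda:=\sum_{r=1}^q\pi_rW_r$. Then for all $k\in\mathbb{N}_0$, $$\|\mathbb{E}[Y^k]-Y^\star\|_\infty\le\|\Lambda^k\|_\infty\cdot\|Y^0-Y^\star\|_\infty .$$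
   Context: Distributed quadratic program: minimize $\sum_{i=1}^N\left(\frac12 x_i^\top Q_ix_i+c_i^\top x_i\right)$ subject to $\sum_{i=1}^N A_ix_i\le b$, with $Q_i\in\mathbb{R}^{n_i\times n_i}$ symmetric positive definite, $c_i\in\mathbb{R}^{n_i}$, $A_i\in\mathbb{R}^{p\times n_i}$, $b\in\mathbb{R}^p$, and constant step sizes $\alpha_i$. Define $$\Phi_i:=\alpha_iA_iQ_i^{-1}A_i^\top,\qquad R:=\sum_{i=1}^N\Phi_i\in\mathbb{R}^{p\times p},\qquad B:=\sum_{i=1}^N\left(-\alpha_iA_iQ_i^{-1}c_i-\tfrac1N\alpha_ib\right)\in\mathbb{R}^p.$$ The dual variable is $y^k\in\mathbb{R}^p$, and the augmented state is $Y^k=[y^{k\top},y^{k-1\top},\ldots,y^{k-q+1\top}]^\top\in\mathbb{R}^{qp}$. $W_r\in\mathbb{R}^{qp\times qp}$ $(r=1,\ldots,q)$ is the $q\times q$ block matrix with $p\times p$ blocks whose first block row is $[I,0,\ldots,0]$ with $R$ subtracted from its $r$-th block, whose block $(j+1,j)$ is $I$ for $j=1,\ldots,q-1$, and whose other blocks are zero (mode $r$ is the update $y^{k+1}=y^k-Ry^{k-r+1}+B$); $C=[B^\top,0,\ldots,0]^\top$. Hence $\Lambda$ has first block row $[I-\pi_1R,-\pi_2R,\ldots,-\pi_qR]$, identity blocks in positions $(j+1,j)$, and zeros elsewhere. Here $\pi_r\ge0$, $\sum_r\pi_r=1$, $\rho$ is the spectral radius, and $\|\cdot\|_\infty$ denotes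 the vector $\infty$-norm and its induced matrix norm. *)

(* Defs.v *)
From HB Require Import structures.
From mathcomp Require Import all_boot all_order all_algebra.
From mathcomp Require Import complex mxtens.
From mathcomp Require Import all_classical all_reals all_analysis.

Set Implicit Arguments.
Unset Strict Implicit.
Unset Printing Implicit Defensive.

Import Order.TTheory GRing.Theory Num.Theory.
Import numFieldNormedType.Exports.

Local Open Scope classical_set_scope.
Local Open Scope ring_scope.

Definition sym_posdef (R : realType) (n : nat) (Q : 'M[R]_n) : Prop :=
  Q^T = Q /\ forall x : 'cV[R]_n, x != 0 -> 0 < (x^T *m Q *m x) 0 0.

(* Eigenvalues are taken over the complex numbers R[i]. The set below is
   finite, and nonempty as soon as n > 0, so its sup is a maximum. *)
Definition spectral_radius (R : realType) (n : nat) (M : 'M[R]_n) : R :=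
  sup [set ComplexField.Normc.normc z | z in
        [set z : R[i] | eigenvalue (map_mx (real_complex R) M) z]].

(* The library norm of a column vector is the maximum of the absolute values
   of its entries. For a matrix it is also the entrywise maximum, which is not
   the operator norm needed here. *)
Definition induced_norm (R : realType) (m n : nat) (M : 'M[R]_(m, n)) : R :=
  sup [set `|M *m x| | x in [set x : 'cV[R]_n | `|x| <= 1]].

Section QuadraticProgram.
Variables (R : realType) (N p : nat) (n : 'I_N -> nat).
Variables (alpha : 'I_N -> R) (Q : forall i, 'M[R]_(n i)).
Variables (c : forall i, 'cV[R]_(n i)) (A : forall i, 'M[R]_(p, n i)).
Variable b : 'cV[R]_p.

Definition Phi_mx (i : 'I_N) : 'M[R]_p :=
  alpha i *: (A i *m invmx (Q i) *m (A i)^T).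

Definition R_mx : 'M[R]_p := \sum_(i < N) Phi_mx i.

Definition B_vec : 'cV[R]_p :=
  \sum_(i < N) (- (alpha i *: (A i *m invmx (Q i) *m c i))
                - (N%:R^-1 * alpha i) *: b).

End QuadraticProgram.

Section AugmentedSystem.
Variables (R : realType) (p q : nat).

(* Modes and blocks are indexed from 0: r : 'I_q stands for the mode r + 1,
   i.e. the update y^{k+1} = y^k - M y^{k-r} + B. *)
Definition W_mx (M : 'M[R]_p) (r : 'I_q) : 'M[R]_(\sum_(i < q) p) :=
  \mxblock_(i < q, j < q)
    (if i == 0%N :> nat then
       (if j == 0%N :> nat then 1%:M else 0) - (if j == r then M else 0)
     else if i == j.+1 :> nat then 1%:M else 0).

Definition C_vec (B : 'cV[R]_p) : 'cV[R]_(\sum_(i < q) p) :=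
  \mxcol_(i < q) (if i == 0%N :> nat then B else 0).

End AugmentedSystem.

Section Probability.
Context d (T : measurableType d) (R : realType) (P : probability T R).

(* E is a set of values, with every subset measurable. *)
Definition discrete_rv (E : Type) (X : T -> E) : Prop :=
  forall D : set E, measurable (X @^-1` D).

Definition mutually_independent (E : Type) (X : nat -> T -> E) : Prop :=
  forall (s : seq nat) (D : nat -> set E), uniq s ->
    P (\bigcap_(k in [set` s]) (X k @^-1` D k)) =
    (\prod_(k <- s) P (X k @^-1` D k))%E.

Definition expectation_cV (m : nat) (X : T -> 'cV[R]_m) : 'cV[R]_m :=
  \col_i fine 'E_P[fun w => X w i 0].

End Probability.

(* Main.v *)
Require Import Defs.
From HB Require Import structures.
From mathcomp Require Import all_boot all_order all_algebra.
From mathcomp Require Import complex mxtens.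
From mathcomp Require Import all_classical all_reals all_analysis.

Set Implicit Arguments.
Unset Strict Implicit.
Unset Printing Implicit Defensive.

Import Order.TTheory GRing.Theory Num.Theory.
Import numFieldNormedType.Exports.

Local Open Scope classical_set_scope.
Local Open Scope ring_scope.

(** The error satisfies Y^k - Y* = W_{sigma_{k-1}} ... W_{sigma_0} (Y^0 - Y* ), a
    function of the finite history (sigma_0, ..., sigma_{k-1}). By independence its
    expectation sums over all histories the products of the pi_r W_r, and
    distributivity of the noncommutative product over the sum turns this into
    Lambda^k (Y^0 - Y* ). *)

(** Rescaling a nonzero [x] to norm 1 puts it in the set whose [sup] is taken; this [sup] is an
    upper bound only once the set is known to be bounded. *)
Lemma induced_norm_ge (R : realType) (m n : nat) (M : 'M[R]_(m, n))
  (x : 'cV[R]_n) : `|M *m x| <= induced_norm M * `|x|.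
Proof.
have entry_le (a b : nat) (B : 'M[R]_(a, b)) i j : `|B i j| <= `|B|.
  rewrite [leRHS]/Num.norm/= mx_normrE.
  exact: (le_bigmax _ (fun ij : 'I_a * 'I_b => `|B ij.1 ij.2|) (i, j)).
have ub : has_ubound [set `|M *m y| | y in [set y : 'cV[R]_n | `|y| <= 1]].
  (* Each entry of [M *m y] is a sum of [n] products, each of absolute value at most [|M|]. *)
  exists (`|M| *+ n) => _ [y /= y1 <-].
  rewrite [leLHS]/Num.norm/= mx_normrE; apply: bigmax_le => [|[i j] _ /=].
    by rewrite mulrn_wge0.
  rewrite mxE; apply: le_trans (ler_norm_sum _ _ _) _.
  rewrite -[X in _ *+ X]card_ord -sumr_const; apply: ler_sum => l _.
  rewrite normrM -[leRHS]mulr1; apply: ler_pM => //.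
  exact: le_trans y1.
have [->|x0] := eqVneq x 0; first by rewrite mulmx0 !normr0 mulr0.
have nx : 0 < `|x| by rewrite normr_gt0.
rewrite -ler_pdivrMr// mulrC -{1}(ger0_norm (ltW nx)) -normfV -normrZ.
apply: ub_le_sup => //; exists (`|x|^-1 *: x); last by rewrite -scalemxAr.
by rewrite /= normrZ normfV normr_id mulVf// gt_eqF.
Qed.

Section FiniteHistory.
Context d (T : measurableType d) (R : realType) (P : probability T R).
Variables (E : finType) (X : nat -> T -> E) (law : nat -> E -> R).
Hypothesis mX : forall k, discrete_rv (X k).
Hypothesis lawX : forall k e, P (X k @^-1` [set e]) = (law k e)%:E.
Hypothesis indepX : mutually_independent P X.

Definition history (k : nat) (w : T) : {ffun 'I_k -> E} :=
  [ffun i : 'I_k => X i w].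

(* For n < k this is [set t n]; for n >= k it is setT, which spares a default
   value in E, possibly empty. *)
Let D k (t : {ffun 'I_k -> E}) (n : nat) : set E :=
  [set e | forall i : 'I_k, i = n :> nat -> t i = e].

(** Puts a cylinder event in the exact shape that [mutually_independent] speaks about. *)
Let preimage_history k (t : {ffun 'I_k -> E}) :
  @history k @^-1` [set t] = \bigcap_(n in [set` iota 0 k]) (X n @^-1` D t n).
Proof.
apply/seteqP; split => w /=.
  by move=> <- n /= _ i <-; rewrite ffunE.
move=> h; apply/ffunP => i; rewrite ffunE.
by have := h i; rewrite /= mem_iota add0n leq0n ltn_ord => /(_ isT) ->.
Qed.

Lemma measurable_history k (t : {ffun 'I_k -> E}) :
  measurable (@history k @^-1` [set t]).
Proof.
rewrite preimage_history bigcap_seq.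
by apply: bigsetI_measurable => n _; exact: mX.
Qed.

Lemma probability_history k (t : {ffun 'I_k -> E}) :
  P (@history k @^-1` [set t]) = (\prod_(i < k) law i (t i))%:E.
Proof.
rewrite preimage_history indepX ?iota_uniq//.
rewrite -{1}[k]subn0 -/(index_iota 0 k) big_mkord -prodEFin; apply: eq_bigr => i _; rewrite -lawX.
(* Every index is now below [k], so [D t i] is the singleton of [t i]. *)
congr (P (_ @^-1` _)); apply/seteqP; split => e /=.
  by move=> /(_ i erefl) ->.
by move=> -> j /val_inj ->.
Qed.

(** There are finitely many histories, so [f (history k w)] is a finite combination of indicators of
    cylinders, and linearity of the integral suffices. *)
Lemma expectation_history k (f : {ffun 'I_k -> E} -> R) :
  ('E_P[fun w => f (history k w)])%E =
  (\sum_(t : {ffun 'I_k -> E}) f t * \prod_(i < k) law i (t i))%:E.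
Proof.
have mh t := @measurable_history k t.
have int1 (t : {ffun 'I_k -> E}) :
    P.-integrable setT (EFin \o (\1_(@history k @^-1` [set t]) : T -> R)).
  by apply: integrable_indic.
have -> : (fun w => f (history k w)) =
    (fun w => \sum_t f t * \1_(@history k @^-1` [set t]) w).
  apply/funext => w; rewrite (bigD1 (history k w))//= big1 ?addr0 => [|t tn].
    by rewrite indicE mem_set// mulr1.
  by rewrite indicE memNset ?mulr0//= => ht; rewrite ht eqxx in tn.
rewrite unlock.
under eq_integral do rewrite -sumEFin.
rewrite integral_sum//; last first.
  by move=> t; apply: eq_integrable (integrableZl measurableT (f t) (int1 t)).
rewrite -sumEFin; apply: eq_bigr => t _.
under eq_integral do rewrite EFinM.
rewrite (integralZl measurableT (int1 t)) integral_indic// setIT EFinM.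
by congr (_ * _)%E; exact: probability_history.
Qed.

End FiniteHistory.

(** Distributivity: one summand for each choice of an index in every factor. The reversal puts the
    latest index leftmost, the order in which the modes act on the state. *)
Lemma expr_sum_scale (R : comPzRingType) (m k : nat) (I : finType)
  (p : I -> R) (M : I -> 'M[R]_m) :
  (\sum_i p i *: M i) ^+ k =
  \sum_(t : {ffun 'I_k -> I}) (\prod_(i < k) p (t i)) *:
    \prod_(i < k) M (t (rev_ord i)).
Proof.
rewrite -[X in _ ^+ X]card_ord -prodr_const bigA_distr_bigA.
rewrite (reindex_inj (h := fun t : {ffun 'I_k -> I} => [ffun i => t (rev_ord i)])).
  apply: eq_bigr => t _.
  (* The scalars commute, so their product can be reversed too; the scalars and the matrices then
     run in step and each scalar is pulled out in turn. *)
  rewrite [X in X *: _](reindex_inj rev_ord_inj)/=.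
  elim/big_rec3: _ => [|i B x A _ ->]; first by rewrite scale1r.
  by rewrite ffunE -!mulmxE -scalemxAl -scalemxAr scalerA.
move=> t u /ffunP tu; apply/ffunP => i.
by have := tu (rev_ord i); rewrite !ffunE rev_ordK.
Qed.

Theorem mainTheorem3 (R : realType)
  (N p q : nat) (hN : (0 < N)%N) (n : 'I_N -> nat)
  (Q : forall i, 'M[R]_(n i)) (hQ : forall i, sym_posdef (Q i))
  (c : forall i, 'cV[R]_(n i)) (A : forall i, 'M[R]_(p, n i))
  (b : 'cV[R]_p) (alpha : 'I_N -> R)
  (W : 'I_q -> 'M[R]_(\sum_(i < q) p)) (hW : W = W_mx (R_mx alpha Q A))
  (C : 'cV[R]_(\sum_(i < q) p)) (hC : C = C_vec q (B_vec alpha Q c A b))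
  (prob : 'I_q -> R) (hprob0 : forall r, 0 <= prob r)
  (hprob1 : \sum_(r < q) prob r = 1)
  (d : measure_display) (T : measurableType d) (P : probability T R)
  (sigma : nat -> T -> 'I_q)
  (hmeas : forall k, discrete_rv (sigma k))
  (hlaw : forall k r, P (sigma k @^-1` [set r]) = (prob r)%:E)
  (hindep : mutually_independent P sigma)
  (Y0 : 'cV[R]_(\sum_(i < q) p)) (Y : nat -> T -> 'cV[R]_(\sum_(i < q) p))
  (hY0 : forall w, Y 0%N w = Y0)
  (hY : forall k w, Y k.+1 w = W (sigma k w) *m Y k w + C)
  (hrho : spectral_radius (\sum_(r < q) prob r *: tensmx (W r) (W r)) < 1)
  (Ystar : 'cV[R]_(\sum_(i < q) p))
  (hYstar : forall r, Ystar = W r *m Ystar + C)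
  (Lambda : 'M[R]_(\sum_(i < q) p))
  (hLambda : Lambda = \sum_(r < q) prob r *: W r) :
  forall k : nat,
    `|expectation_cV P (Y k) - Ystar| <=
    induced_norm (Lambda ^+ k) * `|Y0 - Ystar|.
Proof.
move=> k.
pose M (t : {ffun 'I_k -> 'I_q}) := \prod_(i < k) W (t (rev_ord i)).
have YE w : Y k w = M (history sigma k w) *m (Y0 - Ystar) + Ystar.
  rewrite /M; elim: k @M => [|k IHk] _; first by rewrite hY0 big_ord0 mul1mx subrK.
  (* The factor split off at index 0 is the newest mode, since [rev_ord] sends 0 to [k]; the
     fixed-point equation of that same mode absorbs [C]. *)
  rewrite hY IHk big_ord_recl -mulmxA mulmxDr -addrA -hYstar ffunE/= subn1/=.
  congr (_ *m (_ *m _) + _).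
  by apply: eq_bigr => i _; rewrite !ffunE/= subSS.
suff -> : expectation_cV P (Y k) = Lambda ^+ k *m (Y0 - Ystar) + Ystar.
  by rewrite addrK induced_norm_ge.
(* The weights of the histories have total mass 1, so the constant term [Ystar] survives averaging
   unchanged. *)
have total : \sum_(t : {ffun 'I_k -> 'I_q}) \prod_(i < k) prob (t i) = 1.
  by rewrite -(bigA_distr_bigA (fun _ : 'I_k => prob)) big1.
apply/colP => i; rewrite mxE.
under [X in ('E_P[X])%E]funext do rewrite YE.
rewrite (expectation_history hmeas hlaw hindep
  (fun t => (M t *m (Y0 - Ystar) + Ystar) i 0))/=.
rewrite hLambda expr_sum_scale mulmx_suml mxE summxE.
under eq_bigr do rewrite mxE mulrDl.
rewrite big_split/= -mulr_sumr total mulr1; congr (_ + _).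
by apply: eq_bigr => t _; rewrite -scalemxAl [RHS]mxE mulrC.
Qed.
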